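(* Let $\mathfrak M_n^R$ be the set of permutations $\pi\in S_n$ that avoid the pattern $231$ and the generalized pattern $32\text{-}1$. Then $$\sum_{n\ge0}\sum_{\pi\in\mathfrak M_n^R}w^{\mathrm{fp}(\pi)}x^n =\cfrac{1}{1-wx-\cfrac{x^2}{1-x-M_0(w-1)x^2-\cfrac{x^2}{1-x-M_1(w-1)x^3-\cfrac{x^2}{1-x-M_2(w-1)x^4-\cfrac{x^2}{\ddots}}}}},$$ i.e. after the first level $1-wx$, the $(j+1)$-st level is $1-x-M_j(w-1)x^{j+2}$ for $j=0,1,2,\dots$, all partial numerators being $x^2$.
   Context: A permutation $\pi\in S_n$ avoids $231$ if there are no $i<j<k$ with $\pi_k<\pi_i<\pi_j$; it avoids $32\text{-}1$ if there are no indices $a<b$ with $\pi_{a-1}>\pi_a>\pi_b$ (equivalently, $\pi$ is in $\mathfrak M_n^R$ iff its reversal $\pi_n\cdots\pi_1$ avoids $132$ and has no $a<b$ with $\pi_a<\pi_b<\pi_{b+1}$). $\mathrm{fp}(\pi)$ is the number of fixed points of $\pi$, i.e. indices $i$ with $\pi_i=i$. $M_n$ is the $n$-th Motzkin number (number of lattice paths from $(0,0)$ to $(n,0)$ with steps $(1,1),(1,-1),(1,0)$ never going below the $x$-axis); $M_0=1,M_1=1,M_2=2,\dots$. *)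

(* Defs.v *)
From HB Require Import structures.
From mathcomp Require Import all_boot all_order all_algebra all_fingroup.
From mathcomp Require Import boolp.

Set Implicit Arguments.
Unset Strict Implicit.
Unset Printing Implicit Defensive.

Import GRing.Theory.
Local Open Scope ring_scope.

(* Formal power series R[[x]], with the Cauchy product (not the pointwise one). *)
Record fps (R : Type) := Fps { fps_coef : nat -> R }.

HB.instance Definition _ (R : Type) := gen_eqMixin (fps R).
HB.instance Definition _ (R : Type) := gen_choiceMixin (fps R).

Lemma fpsP (R : Type) (f g : fps R) : fps_coef f =1 fps_coef g <-> f = g.
Proof.
by split=> [|-> //]; case: f g => [f] [g] /= fg; congr Fps; apply: funext.
Qed.

Section FpsRing.

Variable R : comNzRingType.
Implicit Types (f g h : fps R) (c : R).

Definition fps_add f g := Fps (fun n => fps_coef f n + fps_coef g n).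
Definition fps_opp f := Fps (fun n => - fps_coef f n).
Definition fpsC c := Fps (fun n => if n == 0 then c else 0).
Definition fps_mul f g :=
  Fps (fun n => \sum_(i < n.+1) fps_coef f i * fps_coef g (n - i)).
Definition fpsX : fps R := Fps (fun n => (n == 1)%:R).

Fact fps_addA : associative fps_add.
Proof. by move=> f g h; apply/fpsP => n /=; rewrite addrA. Qed.
Fact fps_addC : commutative fps_add.
Proof. by move=> f g; apply/fpsP => n /=; rewrite addrC. Qed.
Fact fps_add0 : left_id (fpsC 0) fps_add.
Proof. by move=> f; apply/fpsP => n /=; rewrite if_same add0r. Qed.
Fact fps_addN : left_inverse (fpsC 0) fps_opp fps_add.
Proof. by move=> f; apply/fpsP => n /=; rewrite if_same addNr. Qed.

HB.instance Definition _ := GRing.isZmodule.Build (fps R)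
  fps_addA fps_addC fps_add0 fps_addN.

Definition fps_trunc N f : {poly R} := \poly_(i < N) fps_coef f i.

Lemma fps_coef_mul_trunc N f g n : (n < N)%N ->
  fps_coef (fps_mul f g) n = (fps_trunc N f * fps_trunc N g)`_n.
Proof.
move=> ltnN; rewrite coefM; apply: eq_bigr => i _; rewrite !coef_poly.
by rewrite (leq_ltn_trans _ ltnN) ?leq_ord // (leq_ltn_trans _ ltnN) ?leq_subr.
Qed.

Fact fps_mulC : commutative fps_mul.
Proof.
by move=> f g; apply/fpsP=> n; rewrite !(fps_coef_mul_trunc (N := n.+1)) // mulrC.
Qed.

Fact fps_mulA : associative fps_mul.
Proof.
move=> f g h; apply/fpsP=> n.
have tr u v : forall i, (i < n.+1)%N ->
  (fps_trunc n.+1 (fps_mul u v))`_i = (fps_trunc n.+1 u * fps_trunc n.+1 v)`_i.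
  by move=> i lt_in; rewrite coef_poly lt_in (fps_coef_mul_trunc _ _ lt_in).
rewrite !(fps_coef_mul_trunc (N := n.+1)) //.
transitivity ((fps_trunc n.+1 f * fps_trunc n.+1 g * fps_trunc n.+1 h)`_n).
  by rewrite -mulrA !coefM; apply: eq_bigr => i _; rewrite tr // ltnS leq_subr.
by rewrite !coefM; apply: eq_bigr => i _; rewrite tr.
Qed.

Fact fps_mul1 : left_id (fpsC 1) fps_mul.
Proof.
move=> f; apply/fpsP => n /=; rewrite big_ord_recl /= mul1r subn0.
by rewrite big1 ?addr0 // => i _; rewrite mul0r.
Qed.

Fact fps_mulDl : left_distributive fps_mul fps_add.
Proof.
move=> f g h; apply/fpsP => n /=; rewrite -big_split /=.
by apply: eq_bigr => i _; rewrite mulrDl.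
Qed.

Fact fps_oner_neq0 : fpsC 1 != 0.
Proof.
apply/eqP => /fpsP/(_ 0) /= /eqP; exact/negP/oner_neq0.
Qed.

HB.instance Definition _ := GRing.Zmodule_isComNzRing.Build (fps R)
  fps_mulA fps_mulC fps_mul1 fps_mulDl fps_oner_neq0.

Lemma fps_coefM f g n :
  fps_coef (f * g) n = \sum_(i < n.+1) fps_coef f i * fps_coef g (n - i).
Proof. by []. Qed.

End FpsRing.

Arguments fpsX {R}.

Section FpsUnitRing.

Variable R : comUnitRingType.
Implicit Types f g : fps R.

Definition fps_unit : {pred fps R} := [pred f | fps_coef f 0 \is a GRing.unit].

(* The first n coefficients of the inverse of f, obtained by solving
   \sum_(i < k.+1) f_(k - i) s_i = [k = 0] for s_k. *)
Fixpoint fps_inv_seq f n : seq R :=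
  if n isn't k.+1 then [::] else
  let s := fps_inv_seq f k in
  rcons s (((k == 0)%:R - \sum_(i < k) fps_coef f (k - i) * s`_i)
             / fps_coef f 0).

Definition fps_inv f : fps R :=
  if f \in fps_unit then Fps (fun n => (fps_inv_seq f n.+1)`_n) else f.

Lemma size_fps_inv_seq f n : size (fps_inv_seq f n) = n.
Proof. by elim: n => //= n IHn; rewrite size_rcons IHn. Qed.

Lemma nth_fps_inv_seq f n i : (i < n)%N ->
  (fps_inv_seq f n)`_i = (fps_inv_seq f i.+1)`_i.
Proof.
elim: n => // n IHn; rewrite ltnS leq_eqVlt => /predU1P[-> //|lt_in].
by rewrite [LHS]/= nth_rcons size_fps_inv_seq lt_in IHn.
Qed.

Fact fps_mulVx : {in fps_unit, left_inverse 1 fps_inv *%R}.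
Proof.
move=> f uf; rewrite mulrC; apply/fpsP => n; rewrite /fps_inv uf.
rewrite mulrC fps_coefM big_ord_recr /= subnn.
rewrite nth_rcons size_fps_inv_seq ltnn eqxx divrK; last exact: uf.
under eq_bigr => i _ do
  rewrite -[rcons _ _]/(fps_inv_seq f i.+1) -(nth_fps_inv_seq f (ltn_ord i)) mulrC.
by rewrite addrC subrK; case: (n == 0).
Qed.

Fact fps_unitPl f g : g * f = 1 -> fps_unit f.
Proof.
move=> /fpsP/(_ 0); rewrite fps_coefM big_ord1 => gf1.
by apply/unitrP; exists (fps_coef g 0); split; rewrite // mulrC.
Qed.

Fact fps_inv_out : {in [predC fps_unit], fps_inv =1 id}.
Proof. by move=> f; rewrite inE /fps_inv => /negbTE ->. Qed.

HB.instance Definition _ := GRing.ComNzRing_hasMulInverse.Build (fps R)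
  fps_mulVx fps_unitPl fps_inv_out.

End FpsUnitRing.

(* Convergence in the x-adic topology: every coefficient is eventually constant. *)
Definition fps_cvg (R : Type) (F : nat -> fps R) (f : fps R) : Prop :=
  forall n : nat, exists N : nat, forall m : nat,
    (N <= m)%N -> fps_coef (F m) n = fps_coef f n.

(* a_j / (b_j - a_(j+1) / (b_(j+1) - ... - a_(j+m) / b_(j+m))) *)
Fixpoint convergent_from (K : unitRingType) (a b : nat -> K) (m j : nat) : K :=
  if m is m'.+1 then a j / (b j - convergent_from a b m' j.+1)
  else a j / b j.

Definition convergent (K : unitRingType) (a b : nat -> K) (m : nat) : K :=
  convergent_from a b m 0.

(* f is the value of the infinite continued fraction a_0 / (b_0 - a_1 / (b_1 - ...)),
   i.e. the limit of its convergents. *)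
Definition is_cfrac (R : comUnitRingType) (f : fps R) (a b : nat -> fps R) :=
  fps_cvg (convergent a b) f.

(* A path with n steps is coded by d : {ffun 'I_n -> 'I_3}, the i-th step being
   (1, d i - 1); motzkin_height d k is its height after k steps. *)
Definition motzkin_height (n : nat) (d : {ffun 'I_n -> 'I_3}) (k : nat) : int :=
  \sum_(i < n | (i < k)%N) ((d i : nat)%:Z - 1).

Definition motzkin (n : nat) : nat :=
  #|[set d : {ffun 'I_n -> 'I_3} |
      [forall k : 'I_n.+1, 0 <= motzkin_height d k]%R
      && (motzkin_height d n == 0)]|.

Definition avoids_231 (n : nat) (s : 'S_n) : bool :=
  [forall i : 'I_n, forall j : 'I_n, forall k : 'I_n,
     ~~ [&& (i < j)%N, (j < k)%N, (s k < s i)%N & (s i < s j)%N]].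

(* Permutations act on {0, ..., n-1}; patterns and fixed points do not depend on
   this shift. The indices written a - 1, a, b in the usual definition of 32-1 are here
   i, j, k: only the first two have to be adjacent. *)
Definition avoids_32_1 (n : nat) (s : 'S_n) : bool :=
  [forall i : 'I_n, forall j : 'I_n, forall k : 'I_n,
     ~~ [&& j == i.+1 :> nat, (j < k)%N, (s j < s i)%N & (s k < s j)%N]].

Definition motzkin_perms_rev (n : nat) : {set 'S_n} :=
  [set s : 'S_n | avoids_231 s && avoids_32_1 s].

Definition fp (n : nat) (s : 'S_n) : nat := #|[set i : 'I_n | s i == i]|.

(* Main.v *)
Require Import Defs.
From mathcomp Require Import all_boot all_order all_algebra all_fingroup.
From mathcomp Require Import zify ring.

(** In a 231-avoiding word with maximum [n], written [s n t], every letter of [s]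
    is below every letter of [t]; if moreover 32-1 is avoided and [t] is nonempty,
    then [t] begins with its minimum.  So a word of the class is either [s n] or a
    direct sum of some [s] and a block [(m+2) 1 t'], with [t'] a shifted word of the
    class of length [m].  Let [F_k] be the generating function of the class
    where [w] marks the [i] with [pi_i = i + k]: the shift by 1 of the values and by 2
    of the positions of [t'] turns [k] into [k + 1], whence
      [F_k = 1 + w^[k=0] x F_k + x^2 F_k (F_(k+1) + [k>0] M_(k-1) (w-1) x^(k-1))],
    the last term coming from the case [m + 1 = k] in which the maximum of the
    block is marked and no letter of [t'] can be.  Without marks, the same
    decomposition gives the recurrence of the Motzkin numbers. *)

Set Implicit Arguments.
Unset Strict Implicit.
Unset Printing Implicit Defensive.

(** * Pattern avoidance in words *)

(** The head plays the 2 of 231; in [seq_avoids_32_1] it plays the 3, with its right neighbour as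
    the 2. *)
Fixpoint seq_avoids_231 (s : seq nat) : bool :=
  if s is a :: s' then
    pairwise (fun b c => ~~ (c < a < b)) s' && seq_avoids_231 s'
  else true.

Fixpoint seq_avoids_32_1 (s : seq nat) : bool :=
  if s is a :: s' then
    (if s' is b :: t then (b < a) ==> all (leq b) t else true)
      && seq_avoids_32_1 s'
  else true.

Definition seq_avoids s := seq_avoids_231 s && seq_avoids_32_1 s.

(* Positions are counted from 0: the letters [s_i] with [s_i = i + k]. *)
Fixpoint shifted_fp (k : nat) (s : seq nat) : nat :=
  if s is a :: s' then (a == k) + shifted_fp k.+1 s' else 0.

Definition motzkin_seqs n := [seq s <- permutations (iota 0 n) | seq_avoids s].

(** With letters counted from 0, the block after [s] is the overall maximum, then the block minimum
    [size s], then [t] shifted above that minimum. *)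
Definition join_max (s t : seq nat) : seq nat :=
  s ++ (size s + size t).+1 :: size s :: map (addn (size s).+1) t.

Lemma mem_motzkin_seqs n s :
  (s \in motzkin_seqs n) = seq_avoids s && perm_eq s (iota 0 n).
Proof. by rewrite mem_filter mem_permutations. Qed.

Lemma motzkin_seqs_uniq n : uniq (motzkin_seqs n).
Proof. by rewrite filter_uniq ?permutations_uniq. Qed.

(** * Avoidance in direct sums *)

(** The last letter of 231 is its smallest, so an occurrence that begins in [s] cannot end in [t].
    The same reason serves for 32-1 below. *)
Lemma seq_avoids_231_cat s t : allrel ltn s t ->
  seq_avoids_231 (s ++ t) = seq_avoids_231 s && seq_avoids_231 t.
Proof.
elim: s => //= a s IHs; rewrite allrel_consl => /andP[/allP a_t s_t].
rewrite IHs // pairwise_cat andbA; congr (_ && _ && _).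
have -> : allrel (fun b c => ~~ (c < a < b)) s t.
  by apply/allrelP => b c _ /a_t /=; lia.
suff -> : pairwise (fun b c => ~~ (c < a < b)) t by rewrite andbT.
apply/(pairwiseP 0) => i j _ ltj _.
by have := a_t _ (mem_nth 0 ltj); rewrite /=; lia.
Qed.

Lemma seq_avoids_32_1_cat s t : allrel ltn s t ->
  seq_avoids_32_1 (s ++ t) = seq_avoids_32_1 s && seq_avoids_32_1 t.
Proof.
elim: s => //= a s IHs; rewrite allrel_consl => /andP[/allP a_t s_t].
rewrite IHs // andbA; congr (_ && _ && _).
case: s s_t {IHs} => [_|b s] /=.
  by case: t a_t => //= c t /(_ c (mem_head _ _)) /=; lia.
rewrite allrel_consl => /andP[/allP b_t _]; rewrite all_cat.
suff -> : all (leq b) t by rewrite andbT.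
by apply/allP => c /b_t /ltnW.
Qed.

Lemma seq_avoids_cat s t : allrel ltn s t ->
  seq_avoids (s ++ t) = seq_avoids s && seq_avoids t.
Proof.
by move=> st; rewrite /seq_avoids seq_avoids_231_cat ?seq_avoids_32_1_cat // andbACA.
Qed.

Lemma seq_avoids_map_addn k s : seq_avoids (map (addn k) s) = seq_avoids s.
Proof.
rewrite /seq_avoids; congr (_ && _); elim: s => //= a s <-; congr (_ && _).
  by rewrite pairwise_map; apply: eq_pairwise => b c; rewrite /= !ltn_add2l.
case: s => //= b s; rewrite ltn_add2l all_map; congr (_ ==> _).
by apply: eq_all => c /=; rewrite leq_add2l.
Qed.

Lemma seq_avoids_ltn a s : all (ltn a) s -> seq_avoids (a :: s) = seq_avoids s.
Proof.
move=> as_; rewrite -[a :: s]cat1s seq_avoids_cat //.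
by rewrite allrel1l.
Qed.

(** An initial maximum cannot be the 2 of 231; as the 3 of 32-1 it needs a letter below [b], and
    there is none. *)
Lemma seq_avoids_max a b s : b < a -> all (ltn b) s -> all (gtn a) s ->
  seq_avoids (a :: b :: s) = seq_avoids s.
Proof.
move=> ba bs sa; rewrite -(seq_avoids_ltn bs).
rewrite /seq_avoids [seq_avoids_231 (a :: _)]/= [seq_avoids_32_1 (a :: _)]/=.
have -> : all (leq b) s by apply: sub_all bs => c /ltnW.
rewrite implybT /=; congr (_ && _).
rewrite -[all _ s && _]/(pairwise (fun b c => ~~ (c < a < b)) (b :: s)).
suff -> : pairwise (fun b c => ~~ (c < a < b)) (b :: s) by [].
apply/(pairwiseP 0) => i j lti ltj _; apply/negP => /andP[_].
have : nth 0 (b :: s) i \in b :: s by apply: mem_nth.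
by rewrite inE => /predU1P[->|/(allP sa)] /=; lia.
Qed.

(* Sorting both halves yields the increasing word [iota m n]. *)
Lemma perm_cat_iota s t m n : allrel ltn s t -> perm_eq (s ++ t) (iota m n) ->
  perm_eq s (iota m (size s)) && perm_eq t (iota (m + size s) (size t)).
Proof.
move=> st p; have sz := perm_size p; rewrite size_cat size_iota in sz.
have: sort leq s ++ sort leq t = iota m n.
  apply: (sorted_eq leq_trans anti_leq) (iota_sorted _ _) _.
    rewrite sorted_pairwise ?pairwise_cat -?sorted_pairwise; try exact: leq_trans.
    rewrite !sort_sorted ?andbT; try exact: leq_total.
    by apply/allrelP => a b; rewrite !mem_sort => /(allrelP st) h /h /ltnW.
  by apply: perm_trans p; rewrite perm_cat ?perm_sort.
rewrite -sz iotaD => /eqP; rewrite eqseq_cat ?size_sort ?size_iota //.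
case/andP=> /eqP <- /eqP <-.
by rewrite perm_sym perm_sort perm_refl perm_sym perm_sort perm_refl.
Qed.

(** * Decomposition of a word at its maximum *)

Lemma perm_iota_lt s n : perm_eq s (iota 0 n) -> all (gtn n) s.
Proof. by move=> p; apply/allP=> a; rewrite (perm_mem p) mem_iota. Qed.

Lemma perm_iota_size s n : perm_eq s (iota 0 n) -> size s = n.
Proof. by move/perm_size; rewrite size_iota. Qed.

Lemma rcons_motzkin_seqs n s :
  (rcons s n \in motzkin_seqs n.+1) = (s \in motzkin_seqs n).
Proof.
rewrite !mem_motzkin_seqs -addn1 iotaD /= add0n cats1 perm_rcons.
rewrite [perm_eq (n :: s) _]perm_sym perm_rcons perm_cons perm_sym.
case p: (perm_eq _ _); rewrite ?andbF // !andbT.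
rewrite -cats1 seq_avoids_cat ?andbT //.
by rewrite allrel1r; apply: perm_iota_lt.
Qed.

Lemma join_max_motzkin_seqs a m s t :
  s \in motzkin_seqs a -> t \in motzkin_seqs m ->
  join_max s t \in motzkin_seqs (a + m).+2.
Proof.
rewrite !mem_motzkin_seqs => /andP[avs ps] /andP[avt pt].
rewrite /join_max (perm_iota_size ps) (perm_iota_size pt).
have lts := allP (perm_iota_lt ps); have ltt := allP (perm_iota_lt pt).
apply/andP; split.
  rewrite seq_avoids_cat; last first.
    apply/allrelP=> b c /lts /= ltb; rewrite !inE => /or3P[/eqP->|/eqP->|]; try lia.
    by case/mapP=> d _ ->; lia.
  rewrite avs seq_avoids_max ?seq_avoids_map_addn //; try lia.
    by apply/allP=> _ /mapP[d _ ->] /=; lia.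
  by apply/allP=> _ /mapP[d /ltt /= ltd ->] /=; lia.
rewrite (_ : (a + m).+2 = a + (m.+2)); last by lia.
rewrite iotaD perm_cat // add0n.
rewrite (_ : iota a m.+2 = a :: iota a.+1 m ++ [:: (a + m).+1]); last first.
  by rewrite -[m.+2]addn1 iotaD /= addnS.
rewrite -cat_cons perm_sym perm_catC /= !perm_cons.
by rewrite -{1}[a.+1]addn0 iotaDl perm_map // perm_sym.
Qed.

Lemma motzkin_seqs_split n l : l \in motzkin_seqs n.+1 ->
  (exists2 s, s \in motzkin_seqs n & l = rcons s n) \/
  (exists s t, [/\ s \in motzkin_seqs (size s), t \in motzkin_seqs (size t),
                 n = (size s + size t).+1 & l = join_max s t]).
Proof.
move=> lG; have := lG; rewrite mem_motzkin_seqs => /andP[av p].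
have nl : n \in l by rewrite (perm_mem p) mem_iota; lia.
case/splitPr: l / nl => [s t] in lG av p *.
case: t => [|a t] in lG av p *.
  left; exists s; last by rewrite cats1.
  by rewrite -rcons_motzkin_seqs -cats1.
right.
have pst : perm_eq (s ++ a :: t) (iota 0 n).
  rewrite -(perm_cons n) (perm_trans _ (perm_trans p _)) //.
    by rewrite -cat1s perm_catCA.
  by rewrite -addn1 iotaD perm_catC /= add0n.
have ust : uniq (s ++ a :: t) by rewrite (perm_uniq pst) iota_uniq.
have ltn_ := allP (perm_iota_lt pst).
(* A letter of [s], then [n], then a smaller letter would form 231; equality is excluded by
   [ust]. *)
have s_t : allrel ltn s (a :: t).
  move: av => /andP[av _]; elim: s {lG p pst} ust ltn_ av => //= b s IHs.
  case/andP=> nb us ltb /andP[pw av]; rewrite allrel_consl IHs //; last first.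
    by move=> c cs; rewrite ltb // inE cs orbT.
  rewrite andbT; apply/allP=> c ct.
  move: pw; rewrite pairwise_cat => /and3P[_ _] /andP[/allP/(_ c ct) + _].
  have := ltb b (mem_head _ _); rewrite /= => ->; rewrite andbT -leqNgt.
  rewrite leq_eqVlt => /predU1P[bc|//].
  by rewrite bc mem_cat ct orbT in nb.
have av2 : seq_avoids (n :: a :: t).
  move: av; rewrite seq_avoids_cat => [/andP[]//|].
  rewrite allrel_consr s_t andbT; apply/allP=> b bs.
  by apply: ltn_; rewrite mem_cat bs.
have avs : seq_avoids s.
  move: av; rewrite seq_avoids_cat => [/andP[]//|].
  rewrite allrel_consr s_t andbT; apply/allP=> b bs.
  by apply: ltn_; rewrite mem_cat bs.
have a_n : a < n by apply: ltn_; rewrite mem_cat mem_head orbT.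
(* The descent [n a] is a 32, so 32-1 forbids any letter of [t] below [a]. *)
have a_t : all (ltn a) t.
  move: av2 => /andP[_] /= /andP[]; rewrite a_n /= => /allP at_ _.
  apply/allP=> b bt; rewrite /= ltn_neqAle at_ // andbT.
  by apply: contraTneq ust => ->; rewrite cat_uniq /= bt /= !andbF.
(* Cutting the interval of values after [s], and again after [a], identifies [a] with [size s]. *)
have /andP[ps] := perm_cat_iota s_t pst; rewrite add0n => pat.
have /andP[] : perm_eq [:: a] [:: size s] && perm_eq t (iota (size s).+1 (size t)).
  have := @perm_cat_iota [:: a] t (size s) (size t).+1 _ pat.
  by rewrite allrel1l addn1; apply.
move=> /perm_mem/(_ a); rewrite !inE eqxx => /esym/eqP a_s pt.
have n_st : n = (size s + size t).+1.
  by move: (perm_iota_size pst); rewrite size_cat /= addnS.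
pose t' := map (subn^~ (size s).+1) t.
have t't : map (addn (size s).+1) t' = t.
  rewrite -map_comp map_id_in // => b; rewrite (perm_mem pt) mem_iota /=; lia.
exists s, t'; rewrite !mem_motzkin_seqs size_map avs ps.
have {}pt : perm_eq t' (iota 0 (size t)).
  apply: (perm_map_inj (@addnI (size s).+1)); rewrite t't (perm_trans pt) //.
  by rewrite -{1}[(size s).+1]addn0 iotaDl.
rewrite pt; split=> //; last by rewrite /join_max t't size_map -n_st a_s.
rewrite -(seq_avoids_map_addn (size s).+1) t't -(seq_avoids_max a_n a_t) ?andbT //.
by apply/allP=> b bt; apply: ltn_; rewrite mem_cat inE bt !orbT.
Qed.

(** The position of the largest letter recovers the cut; the bounds on [s] and [s'] keep that letter
    from occurring earlier. *)
Lemma join_max_inj s t s' t' : all (gtn (size s)) s -> all (gtn (size s')) s' ->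
  join_max s t = join_max s' t' -> s = s' /\ t = t'.
Proof.
move=> lts lts' e.
have := congr1 size e; rewrite !size_cat /= !size_map !addnS => -[sz].
have idx u v n : n = (size u + size v).+1 -> all (gtn (size u)) u ->
    index n (join_max u v) = size u.
  move=> -> ltu; rewrite index_cat; case: ifP => [|_].
    by move/(allP ltu) => /=; lia.
  by rewrite /= eqxx addn0.
have es : size s = size s' by rewrite -(idx s t _ erefl lts) e sz idx.
move: e => /eqP; rewrite eqseq_cat // => /andP[/eqP ->] /eqP[_].
by move/(inj_map (@addnI _)).
Qed.

(** The decomposition is unique, so sums over the class split accordingly. Here [a] is the length of
    the prefix; the maximum and the block minimum leave [n - a.+1] letters. *)
Lemma perm_motzkin_seqs n :
  perm_eq (motzkin_seqs n.+1)
    ([seq rcons s n | s <- motzkin_seqs n] ++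
     [seq join_max p.1 p.2 | a <- iota 0 n,
        p <- [seq (s, t) | s <- motzkin_seqs a, t <- motzkin_seqs (n - a.+1)]]).
Proof.
have sizeP m s : s \in motzkin_seqs m -> size s = m /\ all (gtn m) s.
  by rewrite mem_motzkin_seqs => /andP[_ /[dup] /perm_iota_size-> /perm_iota_lt].
have pairP a p :
    p \in [seq (s, t) | s <- motzkin_seqs a, t <- motzkin_seqs (n - a.+1)] ->
    [/\ p.1 \in motzkin_seqs a, p.2 \in motzkin_seqs (n - a.+1), size p.1 = a,
       all (gtn (size p.1)) p.1 & all (gtn (size p.2)) p.2].
  case/allpairsP=> -[s t] /= [sG tG ->].
  by have [-> lts] := sizeP _ _ sG; have [-> ltt] := sizeP _ _ tG.
apply: uniq_perm; first exact: motzkin_seqs_uniq.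
  rewrite cat_uniq map_inj_uniq ?motzkin_seqs_uniq => [/=|]; last exact: rcons_injl.
  apply/andP; split.
    (* The two families are disjoint: a joined word ends in its block minimum or in a shifted letter
       of [p.2], both below [n]. *)
    apply/hasPn=> _ /allpairsPdep[a [p [_ /pairP[_ _ _ _ ltt] ->]]].
    apply/negP => /mapP[s /sizeP[sz _]] e.
    have := congr1 size e; rewrite size_rcons size_cat /= size_map sz => -[szn].
    have := congr1 (last 0) e; rewrite last_cat last_rcons /= => ln.
    have := mem_last (size p.1) (map (addn (size p.1).+1) p.2).
    rewrite ln inE => /orP[|/mapP[b /(allP ltt)]] /=; lia.
  apply: allpairs_uniq_dep; first exact: iota_uniq.
    move=> a _; apply: allpairs_uniq; try exact: motzkin_seqs_uniq.
    by case=> ? ? [? ?] _ _ [-> ->].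
  move=> u v /allpairsPdep[a [p [_ /pairP[_ _ sz lt _] ->]]].
  case/allpairsPdep=> [a' [p' [_ /pairP[_ _ sz' lt' _] ->]]] /=.
  move/(join_max_inj lt lt') => [e1 e2].
  have aa' : a = a' by rewrite -sz -sz' e1.
  by case: p p' e1 e2 aa' {sz sz' lt lt'} => [s t] [s' t'] /= -> -> ->.
move=> l; rewrite mem_cat; apply/idP/orP.
  case/motzkin_seqs_split=> [[s sG ->]|[s [t [sG tG -> ->]]]].
    by left; apply: map_f.
  right; apply/allpairsPdep; exists (size s), (s, t); split=> //.
    by rewrite mem_iota; lia.
  by apply/allpairsP; exists (s, t); split=> //=; rewrite subSS addKn.
case=> [/mapP[s sG ->]|]; first by rewrite rcons_motzkin_seqs.
case/allpairsPdep=> [a [p [an /pairP[sG tG _ _ _] ->]]].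
have := join_max_motzkin_seqs sG tG.
by rewrite mem_iota /= add0n in an; rewrite (_ : (_ + _).+2 = n.+1) //; lia.
Qed.

(** * Marked letters under the decomposition *)

Lemma shifted_fp_cat k s t :
  shifted_fp k (s ++ t) = shifted_fp k s + shifted_fp (k + size s) t.
Proof.
elim: s k => [|a s IHs] k /=; first by rewrite addn0.
by rewrite IHs addSnnS addnA.
Qed.

Lemma shifted_fp_map_addn c k s :
  shifted_fp (c + k) (map (addn c) s) = shifted_fp k s.
Proof. by elim: s k => //= a s IHs k; rewrite eqn_add2l -addnS IHs. Qed.

(** The maximum exceeds its position by [(size t).+1], whence the middle term. The block minimum
    lies below its position and is never marked. The letters of [t] move by one less than their
    positions, which turns [k] into [k.+1]. *)
Lemma shifted_fp_join_max k s t :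
  shifted_fp k (join_max s t)
  = shifted_fp k s + ((size t).+1 == k) + shifted_fp k.+1 t.
Proof.
rewrite shifted_fp_cat /= -addnA; congr (_ + _).
rewrite (_ : (k + size s).+2 = (size s).+1 + k.+1); last by lia.
rewrite shifted_fp_map_addn addnA; congr (_ + _); lia.
Qed.

Lemma shifted_fp_eq0 k s : all (gtn k) s -> shifted_fp k s = 0.
Proof.
elim: s k => //= a s IHs k /andP[ak sk]; rewrite IHs; first by lia.
by apply: sub_all sk => b /= /ltnW.
Qed.

(** * From permutations to words *)

Lemma seq_avoids_231P (l : seq nat) :
  reflect (forall i j k, i < j < k -> k < size l ->
             ~~ (nth 0 l k < nth 0 l i < nth 0 l j))
          (seq_avoids_231 l).
Proof.
elim: l => [|a l IHl] /=; first by apply: (iffP idP).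
apply: (iffP andP) => [[/(pairwiseP 0) pw /IHl avl]|avl].
  case=> [|i] [|j] [|k] //=.
  - rewrite !ltnS => jk kl; apply: pw => //; exact: ltn_trans kl.
  - by rewrite ltn0 andbF.
  - by rewrite !ltnS; apply: avl.
split; last by apply/IHl => i j k ijk kl; apply: (avl i.+1 j.+1 k.+1).
apply/(pairwiseP 0) => j k _ kl jk; exact: (avl 0 j.+1 k.+1).
Qed.

Lemma seq_avoids_32_1P (l : seq nat) :
  reflect (forall i k, i.+1 < k -> k < size l ->
             ~~ (nth 0 l k < nth 0 l i.+1 < nth 0 l i))
          (seq_avoids_32_1 l).
Proof.
elim: l => [|a l IHl] /=; first by apply: (iffP idP).
apply: (iffP andP) => [[avh /IHl avl]|avl].
  case=> [|i] [|k] //=; last by rewrite !ltnS; apply: avl.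
  case: l avh {IHl avl} => //= b l avh; case: k => // k _ kl.
  apply/negP => /andP[kb ba]; move: avh.
  by rewrite ba /= => /(all_nthP 0)/(_ k kl); rewrite leqNgt kb.
split; last by apply/IHl => i k ik kl; apply: (avl i.+1 k.+1).
case: l avl {IHl} => //= b l avl; apply/implyP => ba.
by apply/(all_nthP 0) => k kl; have := avl 0 k.+2 isT kl; rewrite /= ba andbT -leqNgt.
Qed.

Definition perm_word n (s : 'S_n) : seq nat := [seq val (s i) | i <- enum 'I_n].

Lemma size_perm_word n (s : 'S_n) : size (perm_word s) = n.
Proof. by rewrite size_map size_enum_ord. Qed.

Lemma nth_perm_word n (s : 'S_n) (i : 'I_n) : nth 0 (perm_word s) i = s i.
Proof. by rewrite (nth_map i) ?size_enum_ord // nth_ord_enum. Qed.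

Lemma perm_word_inj n : injective (@perm_word n).
Proof.
move=> s t e; apply/permP => i; apply: val_inj.
by rewrite /= -!nth_perm_word e.
Qed.

(** The map [perm_word] is injective into a set of the same cardinality, the factorial of [n]. *)
Lemma perm_words n :
  perm_eq [seq perm_word s | s <- enum 'S_n] (permutations (iota 0 n)).
Proof.
have U : uniq [seq perm_word s | s : 'S_n].
  by rewrite map_inj_uniq ?enum_uniq //; apply: perm_word_inj.
have sub : {subset [seq perm_word s | s : 'S_n] <= permutations (iota 0 n)}.
  move=> _ /mapP[s _ ->]; rewrite mem_permutations perm_sym.
  apply: uniq_perm; rewrite ?iota_uniq //.
    by rewrite map_inj_uniq ?enum_uniq // => i j /val_inj /perm_inj.
  move=> i; rewrite mem_iota /=; apply/idP/mapP => [lti|[j _ ->]]; last exact: ltn_ord.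
  by exists (s^-1%g (Ordinal lti)); rewrite ?mem_enum // permKV.
have sz : size (permutations (iota 0 n)) <= size [seq perm_word s | s : 'S_n].
  by rewrite size_permutations ?iota_uniq // size_iota size_map -cardE card_Sn.
have [_ eqm] := uniq_min_size U sub sz.
by apply: uniq_perm; rewrite ?permutations_uniq.
Qed.

Lemma avoids_231_word n (s : 'S_n) : avoids_231 s = seq_avoids_231 (perm_word s).
Proof.
apply/idP/seq_avoids_231P => [av i j k /andP[ij jk] kn|av].
  rewrite size_perm_word in kn.
  have jn := ltn_trans jk kn; have i_n := ltn_trans ij jn.
  have := av => /forallP/(_ (Ordinal i_n))/forallP/(_ (Ordinal jn)).
  move/forallP/(_ (Ordinal kn)); rewrite ij jk /= -!nth_perm_word; exact: id.
apply/'forall_'forall_forallP => i j k; rewrite -!nth_perm_word.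
apply/negP => /and4P[ij jk ki ijv].
by have := av i j k; rewrite ij jk ki ijv size_perm_word ltn_ord => /(_ isT isT).
Qed.

Lemma avoids_32_1_word n (s : 'S_n) :
  avoids_32_1 s = seq_avoids_32_1 (perm_word s).
Proof.
apply/idP/seq_avoids_32_1P => [av i k ik kn|av].
  rewrite size_perm_word in kn.
  have jn := ltn_trans ik kn; have i_n := ltn_trans (ltnSn i) jn.
  have := av => /forallP/(_ (Ordinal i_n))/forallP/(_ (Ordinal jn)).
  move/forallP/(_ (Ordinal kn)); rewrite eqxx ik /= -!nth_perm_word andbC.
  exact: id.
apply/'forall_'forall_forallP => i j k; rewrite -!nth_perm_word.
apply/negP => /and4P[/eqP ij jk ji kj].
by have := av i k; rewrite -ij jk ji kj size_perm_word ltn_ord => /(_ isT isT).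
Qed.

Lemma fp_word n (s : 'S_n) : fp s = shifted_fp 0 (perm_word s).
Proof.
have nthE l k : shifted_fp k l = \sum_(i < size l) (nth 0 l i == k + i).
  elim: l k => [|a l IHl] k /=; first by rewrite big_ord0.
  rewrite big_ord_recl addn0 IHl; congr (_ + _).
  by apply: eq_bigr => i _; rewrite addSnnS.
rewrite nthE size_perm_word /fp -sum1dep_card big_mkcond /=.
by apply: eq_bigr => i _; rewrite nth_perm_word add0n -val_eqE; case: eqP.
Qed.

(** * Recurrence for the marked counts *)

Import Order.TTheory GRing.Theory Num.Theory.
Local Open Scope ring_scope.

Lemma sum_motzkin_perms_rev (R : nzRingType) n (g : R) :
  \sum_(s in motzkin_perms_rev n) g ^+ fp s
  = \sum_(l <- motzkin_seqs n) g ^+ shifted_fp 0 l.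
Proof.
rewrite big_filter -(perm_big _ (perm_words n)) big_map /= big_enum_cond /=.
rewrite big_mkcond [RHS]big_mkcond /=; apply: eq_bigr => s _.
by rewrite inE avoids_231_word avoids_32_1_word fp_word.
Qed.

Lemma big_motzkin_seqs (R : nzRingType) (g : seq nat -> R) n :
  \sum_(l <- motzkin_seqs n.+1) g l
  = \sum_(s <- motzkin_seqs n) g (rcons s n)
    + \sum_(a < n) \sum_(s <- motzkin_seqs a)
        \sum_(t <- motzkin_seqs (n - a.+1)) g (join_max s t).
Proof.
rewrite (perm_big _ (perm_motzkin_seqs n)) big_cat big_map; congr (_ + _).
rewrite big_allpairs_dep /= -[n in iota 0 n]subn0 -/(index_iota 0 n) big_mkord.
by apply: eq_bigr => a _; rewrite big_allpairs_dep.
Qed.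

(** The coefficient of [x^n] in the series F_k of the overview, with ['X] as w. *)
Definition shifted_fp_gf (k n : nat) : {poly int} :=
  \sum_(l <- motzkin_seqs n) 'X ^+ shifted_fp k l.

(** A final maximum [n] stands at position [n], so it is marked exactly when [k = 0]. *)
Lemma shifted_fp_gfS k n :
  shifted_fp_gf k n.+1
  = 'X ^+ (k == 0%N) * shifted_fp_gf k n
    + \sum_(a < n) shifted_fp_gf k a
        * ('X ^+ ((n - a.+1).+1 == k) * shifted_fp_gf k.+1 (n - a.+1)).
Proof.
rewrite /shifted_fp_gf big_motzkin_seqs mulr_sumr; congr (_ + _).
  rewrite big_seq [RHS]big_seq; apply: eq_bigr => s.
  rewrite mem_motzkin_seqs => /andP[_ /perm_iota_size sz].
  rewrite -cats1 shifted_fp_cat /= sz addn0 exprD mulrC.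
  by rewrite -[X in X == _](add0n n) eqn_add2r eq_sym.
apply: eq_bigr => a _; rewrite mulr_suml; apply: eq_bigr => s _.
rewrite !mulr_sumr big_seq [RHS]big_seq; apply: eq_bigr => t.
rewrite mem_motzkin_seqs => /andP[_ /perm_iota_size sz].
by rewrite shifted_fp_join_max sz !exprD mulrA.
Qed.

(** All letters are below [k], so none is marked. This evaluates the coefficient in the correction
    term of the overview. *)
Lemma shifted_fp_gf_lt k n : (n <= k)%N ->
  shifted_fp_gf k n = (size (motzkin_seqs n))%:R.
Proof.
move=> nk; rewrite -sum1_size natr_sum; apply: eq_big_seq => l.
rewrite mem_motzkin_seqs => /andP[_ /perm_iota_lt ltl].
rewrite shifted_fp_eq0 //; apply: sub_all ltl => b /= /leq_trans; exact.
Qed.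

(** * Power series coefficients and convergence of continued fractions *)

Section FpsCoef.

Variable R : comNzRingType.
Implicit Types (f g : fps R) (c : R).

Lemma fps_coefD f g n : fps_coef (f + g) n = fps_coef f n + fps_coef g n.
Proof. by []. Qed.

Lemma fps_coefB f g n : fps_coef (f - g) n = fps_coef f n - fps_coef g n.
Proof. by []. Qed.

Lemma fps_coef1 n : fps_coef (1 : fps R) n = (n == 0%N)%:R.
Proof. by rewrite /=; case: eqP. Qed.

Lemma fps_coefCM c f n : fps_coef (fpsC c * f) n = c * fps_coef f n.
Proof.
rewrite fps_coefM big_ord_recl /= subn0 big1 ?addr0 // => i _.
by rewrite mul0r.
Qed.

Lemma fps_coef0M f g : fps_coef (f * g) 0 = fps_coef f 0 * fps_coef g 0.
Proof. by rewrite fps_coefM big_ord1. Qed.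

Lemma fps_coef0XM f : fps_coef (fpsX * f) 0 = 0.
Proof. by rewrite fps_coef0M mul0r. Qed.

Lemma fps_coefSXM f n : fps_coef (fpsX * f) n.+1 = fps_coef f n.
Proof.
rewrite fps_coefM big_ord_recl /= mul0r add0r big_ord_recl /= mul1r subSS subn0.
by rewrite big1 ?addr0 // => i _; rewrite mul0r.
Qed.

Lemma fps_coefX2M f n : fps_coef (fpsX ^+ 2 * f) n.+2 = fps_coef f n.
Proof. by rewrite expr2 -mulrA !fps_coefSXM. Qed.

Lemma fps_coefXnM_lt f m n : (n < m)%N -> fps_coef (fpsX ^+ m * f) n = 0.
Proof.
elim: m n => // m IHm [|n] ltnm; rewrite exprS -mulrA ?fps_coef0XM //.
by rewrite fps_coefSXM IHm.
Qed.

Lemma fps_coefXn m n : fps_coef (fpsX ^+ m : fps R) n = (n == m)%:R.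
Proof.
elim: m n => [|m IHm] [|n]; rewrite ?expr0 ?fps_coef1 // exprS.
  by rewrite fps_coef0XM.
by rewrite fps_coefSXM IHm.
Qed.

Lemma fpsCD c d : fpsC (c + d) = fpsC c + fpsC d.
Proof. by apply/fpsP => n /=; case: eqP; rewrite ?addr0. Qed.

Lemma fpsC_nat n : fpsC n%:R = n%:R :> fps R.
Proof. by elim: n => [//|n IHn]; rewrite !mulrS fpsCD IHn. Qed.

End FpsCoef.

(* The j-th tail of the fraction is [a j * f j]; replacing it by its m-th
   convergent changes it by a multiple of [x ^+ m]. *)
Lemma is_cfrac_tails (R : comUnitRingType) (f a b c : nat -> fps R) :
  (forall j, fps_coef (b j) 0 = 1) ->
  (forall j, a j.+1 = fpsX * c j) ->
  (forall j, f j * (b j - a j.+1 * f j.+1) = 1) ->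
  is_cfrac (a 0%N * f 0%N) a b.
Proof.
move=> b0 aX fE.
have H m : forall j, exists e,
    convergent_from a b m j = a j * (f j + fpsX ^+ m * e).
  elim: m => [|m IHm] j.
    by exists ((b j)^-1 - f j); rewrite /= expr0 mul1r addrC subrK.
  have [e /= ->] := IHm j.+1.
  set D := b j - _.
  (* As [a j.+1] is a multiple of [x], the constant term of [D] is that of [b j], namely 1. *)
  have uD : D \is a GRing.unit.
    rewrite /D aX -mulrA; apply: (_ : fps_coef _ 0 \is a GRing.unit).
    by rewrite fps_coefB fps_coef0XM subr0 b0 unitr1.
  (* By [fE], [f j * D = 1 - x^(m+1) * f j * c j * e]; dividing by [D] gives the new error term,
     with one more factor [x]. *)
  exists (f j * c j * e / D); congr (_ * _); apply: (mulIr uD).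
  rewrite mulVr // mulrDl -!mulrA mulVr // mulr1 -(fE j) /D aX exprS; ring.
move=> n; exists n.+1 => m ltnm; have [e ce] := H m 0%N.
rewrite /convergent ce mulrDr fps_coefD [a 0%N * (_ * _)]mulrCA.
by rewrite fps_coefXnM_lt // addr0.
Qed.

(** * Motzkin paths and their generating function *)

Lemma forall_ordS n (P : pred nat) :
  [forall k : 'I_n.+1, P k] = P 0%N && [forall k : 'I_n, P k.+1].
Proof.
apply/forallP/andP => [h|[p0 /forallP h] k].
  by split; [apply: (h ord0)|apply/forallP => k; apply: (h (lift ord0 k))].
by case: (unliftP ord0 k) => [j ->|->] //; apply: h.
Qed.

Definition ffun_cons (T : Type) n (p : T * {ffun 'I_n -> T}) : {ffun 'I_n.+1 -> T} :=
  [ffun i => if unlift ord0 i is Some j then p.2 j else p.1].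

Lemma ffun_cons_bij (T : finType) n : bijective (@ffun_cons T n).
Proof.
exists (fun d : {ffun 'I_n.+1 -> T} => (d ord0, [ffun j => d (lift ord0 j)])).
  move=> [c d]; rewrite /ffun_cons ffunE unlift_none /=; congr (_, _).
  by apply/ffunP => j; rewrite !ffunE liftK.
move=> d; apply/ffunP => i; rewrite ffunE /=.
by case: unliftP => [j ->|->]; rewrite ?ffunE.
Qed.

Lemma motzkin_height_cons n (c : 'I_3) (d : {ffun 'I_n -> 'I_3}) k :
  motzkin_height (ffun_cons (c, d)) k.+1 = (c : nat)%:Z - 1 + motzkin_height d k.
Proof.
rewrite /motzkin_height big_mkcond big_ord_recl ffunE unlift_none; congr (_ + _).
by rewrite [RHS]big_mkcond; apply: eq_bigr => i _; rewrite ffunE liftK.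
Qed.

(** The starting height varies so that a first step can be removed. It is an integer so that a step
    down from 0 needs no separate case: the count is then 0. *)
Definition motzkin_from (h : int) (n : nat) : nat :=
  #|[set d : {ffun 'I_n -> 'I_3} |
      [forall k : 'I_n.+1, 0 <= h + motzkin_height d k]%R
      && (h + motzkin_height d n == 0)]|.

Lemma motzkin_height0 n (d : {ffun 'I_n -> 'I_3}) : motzkin_height d 0 = 0.
Proof. by rewrite /motzkin_height big_pred0. Qed.

Lemma motzkin_from0 n : motzkin_from 0 n = motzkin n.
Proof.
apply: eq_card => d; rewrite !inE add0r; congr (_ && _).
by apply: eq_forallb => k; rewrite add0r.
Qed.

Lemma motzkin_from_lt0 h n : h < 0 -> motzkin_from h n = 0%N.
Proof.
move=> h0; apply: eq_card0 => d; rewrite !inE.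
by apply/negP => /andP[/forallP/(_ ord0)]; rewrite motzkin_height0 addr0 leNgt h0.
Qed.

Lemma motzkin_from_0 (h : nat) : motzkin_from h%:Z 0 = (h == 0)%N.
Proof.
rewrite /motzkin_from -sum1dep_card big_mkcond /=.
rewrite (eq_bigr (fun=> nat_of_bool (h == 0%N))) => [|d _].
  by rewrite sum_nat_const card_ffun !card_ord mul1n.
rewrite (@forall_ordS 0 (fun k => 0 <= h%:Z + motzkin_height d k)).
rewrite motzkin_height0 addr0 lez_nat /= eqz_nat.
by case: forallP => [_|[]]; [case: eqP|case].
Qed.

(** The first step leads to height [h - 1], [h] or [h + 1]; the condition at time 0 holds because
    [h] is natural. *)
Lemma motzkin_fromS (h : nat) n :
  motzkin_from h%:Z n.+1
  = (motzkin_from (h%:Z - 1) n + motzkin_from h%:Z n + motzkin_from (h%:Z + 1) n)%N.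
Proof.
rewrite {1}/motzkin_from -sum1dep_card (reindex _ (onW_bij _ (@ffun_cons_bij _ n))) /=.
rewrite (eq_bigl (fun p : 'I_3 * {ffun 'I_n -> 'I_3} =>
   [forall k : 'I_n.+1, 0 <= (h%:Z + (p.1 : nat)%:Z - 1) + motzkin_height p.2 k]
   && ((h%:Z + (p.1 : nat)%:Z - 1) + motzkin_height p.2 n == 0))); last first.
  case=> c d; rewrite motzkin_height_cons !addrA; congr (_ && _).
  rewrite (@forall_ordS n.+1 (fun k => 0 <= h%:Z + motzkin_height (ffun_cons (c, d)) k)).
  rewrite motzkin_height0 addr0 lez_nat /=.
  by apply: eq_forallb => k; rewrite motzkin_height_cons !addrA.
rewrite -(pair_big_dep xpredT (fun (c : 'I_3) d =>
   [forall k : 'I_n.+1, 0 <= (h%:Z + (c : nat)%:Z - 1) + motzkin_height d k]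
   && ((h%:Z + (c : nat)%:Z - 1) + motzkin_height d n == 0)) (fun _ _ => 1%N)) /=.
rewrite !big_ord_recl big_ord0 addn0 !sum1dep_card addnA /=.
by rewrite addr0 addrK -addrA.
Qed.

Lemma motzkin_gf (R : comNzRingType) (M : fps R) :
  M = 1 + fpsX * M + fpsX ^+ 2 * M ^+ 2 ->
  forall n, fps_coef M n = (motzkin n)%:R.
Proof.
move=> ME n.
(* First-step decomposition of paths from height h matches the expansion of one
   factor M of x^h M^(h+1). *)
suff H m : forall h : nat,
    fps_coef (fpsX ^+ h * M ^+ h.+1) m = (motzkin_from h%:Z m)%:R.
  by rewrite -motzkin_from0 -(H n 0%N) expr0 mul1r expr1.
(* At height 0 there is no step down; the constant 1 stands for the empty path. *)
have E0 : M = 1 + fpsX * (M + fpsX * M ^+ 2) by rewrite {1}ME; ring.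
have ES h : fpsX ^+ h.+1 * M ^+ h.+2
    = fpsX * (fpsX ^+ h * M ^+ h.+1 + fpsX ^+ h.+1 * M ^+ h.+2
              + fpsX ^+ h.+2 * M ^+ h.+3).
  by rewrite [M ^+ h.+2]exprSr {2}ME !exprS; ring.
elim: m => [|m IHm] [|h].
- by rewrite expr0 mul1r expr1 E0 fps_coefD fps_coef0XM addr0 fps_coef1 motzkin_from_0.
- by rewrite ES fps_coef0XM motzkin_from_0.
- rewrite expr0 mul1r expr1 {1}E0 fps_coefD fps_coefSXM fps_coef1 add0r fps_coefD.
  have := IHm 0%N; rewrite expr0 mul1r expr1 => ->.
  have := IHm 1%N; rewrite expr1 => ->.
  by rewrite motzkin_fromS (@motzkin_from_lt0 (0 - 1)) // add0n natrD.
rewrite ES fps_coefSXM !fps_coefD !IHm motzkin_fromS !natrD.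
congr (_%:R + _ + _%:R); first by congr motzkin_from; lia.
by congr motzkin_from; lia.
Qed.

(** * Functional equations and the continued fraction *)

Definition shifted_fp_fps (k : nat) : fps {poly int} := Fps (shifted_fp_gf k).

(** The mark of the block maximum depends on the length [m] of the rest of the block, so it stays
    inside the coefficients of the second factor. *)
Lemma shifted_fp_fps_rec k :
  shifted_fp_fps k
  = 1 + fpsC ('X ^+ (k == 0%N)) * fpsX * shifted_fp_fps k
    + fpsX ^+ 2 * (shifted_fp_fps k *
        Fps (fun m => 'X ^+ (m.+1 == k) * shifted_fp_gf k.+1 m)).
Proof.
apply/fpsP => -[|n].
  rewrite !fps_coefD fps_coef1 -mulrA fps_coefCM fps_coef0XM mulr0 addr0.
  rewrite fps_coefXnM_lt // addr0 /= /shifted_fp_gf.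
  by rewrite (_ : motzkin_seqs 0 = [:: [::]]) // big_seq1 expr0.
rewrite !fps_coefD fps_coef1 add0r -mulrA fps_coefCM fps_coefSXM.
rewrite [LHS]/= shifted_fp_gfS; congr (_ + _).
case: n => [|n]; first by rewrite big_ord0 expr2 -mulrA fps_coefSXM fps_coef0XM.
by rewrite fps_coefX2M fps_coefM.
Qed.

(** No bijection between words and paths is built: the decomposition yields the equation
    [M = 1 + x M + x^2 M^2], which determines the coefficients. *)
Lemma size_motzkin_seqs (R : comNzRingType) n :
  (size (motzkin_seqs n))%:R = (motzkin n)%:R :> R.
Proof.
pose M : fps R := Fps (fun n => (size (motzkin_seqs n))%:R).
rewrite -[LHS]/(fps_coef M n); apply: motzkin_gf; apply/fpsP => -[|{}n].
  rewrite !fps_coefD fps_coef1 fps_coef0XM addr0.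
  by rewrite fps_coefXnM_lt // addr0.
rewrite !fps_coefD fps_coef1 add0r fps_coefSXM.
rewrite [LHS]/= [X in _ = X + _]/= -!sum1_size !natr_sum big_motzkin_seqs.
congr (_ + _).
transitivity (\sum_(a < n) fps_coef M a * fps_coef M (n - a.+1)).
  apply: eq_bigr => a _; rewrite /= -!sum1_size !natr_sum mulr_suml.
  by apply: eq_bigr => s _; rewrite mulr_sumr; apply: eq_bigr => t _; rewrite mulr1.
case: n => [|n]; first by rewrite big_ord0 expr2 -mulrA fps_coefSXM fps_coef0XM.
by rewrite fps_coefX2M expr2 fps_coefM.
Qed.

Theorem theorem2p4 :
  let x : fps {poly int} := fpsX in
  let w : fps {poly int} := fpsC 'X in
  is_cfrac
    (Fps (fun n : nat =>
       \sum_(s in motzkin_perms_rev n) ('X : {poly int}) ^+ fp s))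
    (fun j : nat => if j is 0%N then 1 else x ^+ 2)
    (fun j : nat => if j is i.+1
       then 1 - x - (motzkin i)%:R * (w - 1) * x ^+ i.+2
       else 1 - w * x).
Proof.
move=> x w.
have -> : Fps (fun n => \sum_(s in motzkin_perms_rev n) ('X : {poly int}) ^+ fp s)
    = 1 * shifted_fp_fps 0.
  by rewrite mul1r; congr Fps; apply: boolp.funext => n; apply: sum_motzkin_perms_rev.
pose a (j : nat) : fps {poly int} := if j is 0%N then 1 else x ^+ 2.
rewrite -[1 * _]/(a 0%N * _); apply: (@is_cfrac_tails _ _ _ _ (fun=> x)).
- move=> [|i]; first by rewrite mulrC fps_coefB fps_coef0XM subr0 fps_coef1.
  rewrite exprS mulrCA.
  by rewrite !fps_coefB !fps_coef0XM -[x]mulr1 fps_coef0XM !subr0 fps_coef1.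
- by move=> j; rewrite /= expr2.
(* Turns a functional equation into the relation between consecutive tails required by
   [is_cfrac_tails]. *)
have fracE (f g c : fps {poly int}) :
    f = 1 + c * f + x ^+ 2 * (f * g) -> f * (1 - c - x ^+ 2 * g) = 1.
  move=> E; transitivity (f - (c * f + x ^+ 2 * (f * g))); first by ring.
  by rewrite {1}E; ring.
case=> [|k].
  apply: (fracE _ _ (w * x)); rewrite {1}shifted_fp_fps_rec expr1.
  (* For [k = 0] no block maximum is marked, since [m.+1] is never 0. *)
  congr (_ + _ * (_ * _)); apply/fpsP => m /=.
  by rewrite mul1r.
change (shifted_fp_fps k.+1 * (1 - x - (motzkin k)%:R * (w - 1) * x ^+ k.+2
  - x ^+ 2 * shifted_fp_fps k.+2) = 1).
rewrite -[1 - x - _]addrA -opprD.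
apply: fracE; rewrite {1}shifted_fp_fps_rec expr0 -/x.
(* Only the coefficient at [m = k] is altered: there the second series has the constant M_k, and the
   mark replaces it by [w M_k]. The factor [x^2] then lifts the correction to degree [k + 2]. *)
have -> : Fps (fun m => 'X ^+ (m.+1 == k.+1) * shifted_fp_gf k.+2 m)
    = shifted_fp_fps k.+2 + (motzkin k)%:R * (w - 1) * x ^+ k.
  apply/fpsP => m.
  rewrite -fpsC_nat -mulrA fps_coefD fps_coefCM mulrBl mul1r fps_coefB.
  rewrite fps_coefCM fps_coefXn [LHS]/= [X in X + _]/= eqSS.
  case: eqP => [->|_]; last by rewrite expr0 mul1r mulr0 subr0 mulr0 addr0.
  rewrite (shifted_fp_gf_lt (leqW (leqnSn k))) size_motzkin_seqs mulr1 expr1.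
  by rewrite mulrBr mulr1 addrC subrK mulrC.
rewrite -[fpsC 1]/(1 : fps {poly int}) !exprS; ring.
Qed.
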